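(* Let $X$ be a $q$-homogeneous tree with $q\ge 2$ and origin $o$, and let $\alpha>1$. There is a constant $C>0$, depending only on $q$ and $\alpha$, such that the following holds. Let $f\in L^1_\alpha$ and $t>\|f\|_{L^1_\alpha}/\mu_\alpha(X)$. There exist two families $\mathcal{Q}$ and $\mathcal{F}$ of pairwise disjoint subsets of $X$, each member of which is either a singleton $\{u\}$ with $u\in X$ or a sector $T_u$ with $u\in X\setminus\{o\}$, such that, denoting by $\Omega$ and $F$ the disjoint unions of all the sets in $\mathcal{Q}$ and in $\mathcal{F}$, respectively: 1. $X=\Omega\sqcup F$ (disjoint union); 2. $|f(z)|\le t$ for every $z\in F$; 3. there exist $g,b:X\to\mathbb{C}$ such that $f=g+b$, $\mathrm{supp}\,b\subseteq\Omega$, and $\|g\|_{L^2_\alpha}^2\le C\,t\,\|f\|_{L^1_\alpha}$. Moreover, setting $b_Q=b\,\mathbbm{1}_Q$ for $Q\in\mathcal{Q}$, $$\sum_{z\in Q}b_Q(z)q^{-\alpha|z|}=0\ \text{ for every } Q\in\mathcal{Q},\qquad \sum_{Q\in\mathcal{Q}}\|b_Q\|_{L^1_\alpha}\le C\|f\|_{L^1_\alpha}.$$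
   Context: A $q$-homogeneous tree $X$ ($q\ge 2$ an integer) is an undirected connected cycle-free graph in which every vertex has exactly $q+1$ neighbours; $X$ also denotes its vertex set, $o\in X$ is a fixed origin and $|x|$ is the graph distance of $x$ from $o$. $[o,x]$ is the unique path from $o$ to $x$. The sector of $u\neq o$ is $T_u=\{x\in X:[o,u]\subseteq[o,x]\}$. $\mu_\alpha$ is the finite measure on $X$ with density $q^{-\alpha|x|}$ with respect to the counting measure, and $L^p_\alpha$ is the space of $f:X\to\mathbb{C}$ with $\|f\|_{L^p_\alpha}^p=\sum_{x\in X}|f(x)|^pq^{-\alpha|x|}<\infty$. $\mathbbm{1}_Q$ is the characteristic function of $Q$ and $\mathrm{supp}\,b=\{x:b(x)\neq0\}$. *)

(* Defs.v *)
From HB Require Import structures.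
From mathcomp Require Import all_boot all_order all_algebra finmap.
From mathcomp Require Import all_classical all_reals all_analysis.
From mathcomp Require Import complex.
From mathcomp.analysis.showcase Require summability.
Set Implicit Arguments.
Unset Strict Implicit.
Unset Printing Implicit Defensive.
Import Order.TTheory GRing.Theory Num.Theory numFieldNormedType.Exports.
Local Open Scope classical_set_scope.
Local Open Scope ring_scope.

Record homogeneous_tree (q : nat) (X : choiceType) (adj : rel X) : Prop := {
  adj_sym : symmetric adj ;
  adj_irr : irreflexive adj ;
  adj_connected : forall x y, exists2 p, path adj x p & last x p = y ;
  (* an undirected edge is itself a simple closed walk of size 2 *)
  adj_acyclic : forall c : seq X, ucycle adj c -> (size c <= 2)%N ;
  adj_regular : forall x, ([set y | adj x y] #= `I_q.+1)%card
}.

Section Graph.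
Variables (X : choiceType) (adj : rel X).

Definition walk_length (x y : X) : set nat :=
  [set n | exists p, [/\ path adj x p, last x p = y & size p = n]].

(* Junk value 0 if x and y are not connected. *)
Definition gdist (x y : X) : nat :=
  xget 0%N [set n | walk_length x y n /\ lbound (walk_length x y) n].

(* The vertices lying on a simple path from x to y, which is unique in a
   tree. *)
Definition segment (x y : X) : set X :=
  [set z | exists p, [/\ path adj x p, last x p = y, uniq (x :: p)
                       & z \in x :: p]].

Definition sector (o u : X) : set X :=
  [set x | segment o u `<=` segment o x].

Definition singleton_or_sector (o : X) (A : set X) : Prop :=
  (exists u, A = [set u]) \/ (exists2 u, u != o & A = sector o u).

End Graph.

Section Weighted.
Variables (R : realType) (q : nat) (alpha : R).
Variables (X : choiceType) (adj : rel X) (o : X).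

Definition weight (x : X) : R := q%:R `^ (- (alpha * (gdist adj o x)%:R)).

Definition mu (A : set X) : \bar R := \esum_(x in A) (weight x)%:E.

Definition Lp_norm (p : R) (f : X -> R[i]) : \bar R :=
  ((\esum_(x in [set: X]) (Normc.normc (f x) `^ p * weight x)%:E) `^ p^-1)%E.

Definition in_Lp (p : R) (f : X -> R[i]) : Prop := (Lp_norm p f < +oo)%E.

End Weighted.

(* The family (u z), z in D, is unconditionally summable with sum l: its sums
   over the finite subsets of D converge to l along inclusion. *)
Definition has_sum (R : realType) (X : choiceType) (D : set X) (u : X -> R[i])
    (l : R[i]) : Prop :=
  (fun A : {fset X} => (\sum_(z <- A | z \in D) u z : R[i]^o))
    @ @summability.totally X --> (l : R[i]^o).

(* Main.v *)
Require Import Defs.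
From mathcomp Require Import all_boot all_order all_algebra finmap.
From mathcomp Require Import all_classical all_reals all_analysis.
From mathcomp Require Import complex.
From mathcomp.analysis.showcase Require summability.
From mathcomp Require Import zify lra ring.
Set Implicit Arguments.
Unset Strict Implicit.
Unset Printing Implicit Defensive.
Import Order.TTheory GRing.Theory Num.Theory numFieldNormedType.Exports.
Local Open Scope classical_set_scope.
Local Open Scope ring_scope.

Import Normc.
#[local] Existing Instance summability.totally_filter.

(** This is a Calderon-Zygmund decomposition by a stopping argument. The whole
tree splits into the origin and the sectors of its neighbours, and every other
sector [T_u] splits into [{u}] and the sectors of the children of [u]; so
sectors and singletons play the part of dyadic cubes. Two of them are nested or
disjoint ([sector_meet]).

The measure is not doubling, yet a sector and its pieces have comparable masses.
Each vertex other than the origin has [q] children, whose weights are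
[q^(-alpha)] times its own, so the mass of [T_u] is the weight of [u] times a
geometric series of ratio [q^(1 - alpha) < 1] ([sector_mass]). Hence the mass of
any sector is at most a constant times the weight of [u], and this weight is at
most [q^alpha] times the weight of a child of [u]: with
[D = 2 K q^alpha], [K] being the sum of the series, a sector has at most [D]
times the mass of each of its pieces.

Call a sector heavy if the average of [|f|] over it exceeds [t]. The tree itself
is not heavy, by the assumption on [t]. The family [Q] consists of the maximal
heavy sectors and of the singletons [{u}] with [|f(u)| > t] which lie in no
heavy sector; the family [F] consists of the remaining singletons. The parent of
a member of [Q] is not heavy, so the average of [|f|] over that member is at
most [D t].

The rest holds on any weighted set ([calderon_zygmund]): [g] is the average of
[f] on each member of [Q], and [f] elsewhere. Then [|g| <= D t] and the [L^1]
norm of [g] is at most that of [f], whence [||g||_2^2 <= D t ||f||_1]; and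
[b = f - g] has mean zero on each member of [Q], with
[||b||_1 <= ||f||_1 + ||g||_1 <= 2 ||f||_1]. So [C = D] works. *)

(** * Summation over arbitrary index sets *)

Section EsumExtra.
Variables (R : realType) (T X : choiceType).

Lemma esum_trivIset (I : set T) (J : T -> set X) (a : X -> \bar R) :
  trivIset I J -> (forall x, 0 <= a x)%E ->
  \esum_(x in \bigcup_(i in I) J i) a x = \esum_(i in I) \esum_(x in J i) a x.
Proof.
move=> tJ a0; rewrite esum_esum//.
rewrite (_ : \bigcup_(i in I) J i = snd @` (I `*`` J)).
  apply: esum_image => -[i x] [j y] /set_mem[/= Ii Jx] /set_mem[/= Ij Jy] xy.
  by subst y; congr (_, _); apply: tJ => //; exists x.
apply/seteqP; split=> [x [i Ii Jx]|_ [[i x] [/= Ii Jx] <-]].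
  by exists (i, x).
by exists i.
Qed.

Lemma esum_subset (A B : set X) (a : X -> \bar R) :
  A `<=` B -> (forall x, 0 <= a x)%E ->
  (\esum_(x in A) a x <= \esum_(x in B) a x)%E.
Proof.
move=> AB a0; rewrite esum_mkcond [leRHS]esum_mkcond; apply: le_esum => x _.
case: ifPn => [xA|_]; last by case: ifP.
by rewrite ifT// inE; apply: AB; rewrite inE in xA.
Qed.

Lemma le_esum_mem (D : set X) (a : X -> \bar R) x :
  D x -> (forall x, 0 <= a x)%E -> (a x <= \esum_(x in D) a x)%E.
Proof.
move=> Dx a0; rewrite -[leLHS](esum_set1 (a0 x)).
by apply: esum_subset => // _ ->.
Qed.

Lemma esumZ_le (D : set X) (c : R) (a : X -> R) :
  0 <= c ->
  (\esum_(x in D) (c * a x)%:E <= c%:E * \esum_(x in D) (a x)%:E)%E.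
Proof.
move=> c0; apply: ge_ereal_sup => _ [Y [finY YD]] <-.
have -> : (\sum_(x \in Y) (c * a x)%:E = c%:E * \sum_(x \in Y) (a x)%:E)%E.
  have [Z ZE] := finite_fsetP.1 finY.
  by rewrite ZE -!fsbig_seq ?fset_uniq//= !sumEFin -EFinM mulr_sumr.
rewrite lee_wpmul2l ?lee_fin//; apply: esum_ge; exists Y => //.
Qed.

(** Finite partial sums in the form that occurs in [has_sum]. *)
Lemma esum_ge_fset (D : set X) (A : {fset X}) (v : X -> R) :
  ((\sum_(z <- A | z \in D) v z)%:E <= \esum_(z in D) (v z)%:E)%E.
Proof.
apply: esum_ge; exists (D `&` [set` A]).
  by split => //; exact: finite_setIr.
rewrite fsbig_mkcondl -fsbig_seq ?fset_uniq//= -sumEFin big_mkcond.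
exact: lexx.
Qed.

End EsumExtra.

(** Subadditivity: the pieces may overlap, so no disjointness has to be checked
when a sector is covered by smaller ones. *)
Lemma esum_cover_le (R : realType) (T X : choiceType) (s : seq T)
    (J : T -> set X) (A : set X) (a : X -> \bar R) :
  (forall x, 0 <= a x)%E -> (forall x, A x -> exists2 i, i \in s & J i x) ->
  (\esum_(x in A) a x <= \sum_(i <- s) \esum_(x in J i) a x)%E.
Proof.
move=> a0 AJ; under eq_bigr do rewrite esum_mkcond.
rewrite esum_mkcond -esum_sum; last by move=> x i _ _; case: ifP.
apply: le_esum => x _; case: ifPn => [/set_mem/AJ[i si Jx]|_]; last first.
  by apply: sume_ge0 => i _; case: ifP.
rewrite (big_rem i)//= mem_set// leeDl//.
by apply: sume_ge0 => j _; case: ifP.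
Qed.

Section HasSum.
Variables (R : realType) (X : choiceType).
Implicit Types (D : set X) (u v : X -> R[i]).

Lemma normcE_C (x : R[i]) : `|x| = (normc x)%:C%C. Proof. by []. Qed.

Lemma normc_real (x : R) : normc x%:C%C = `|x|.
Proof. by rewrite /normc /= expr0n addr0 sqrtr_sqr. Qed.

Lemma normc_ge0 (x : R[i]) : 0 <= normc x.
Proof. by rewrite -lecR; exact: (@normr_ge0 _ R[i]). Qed.

Lemma ler_normcD (x y : R[i]) : normc (x + y) <= normc x + normc y.
Proof. by rewrite -lecR rmorphD/=; exact: (@ler_normD _ R[i]). Qed.

Lemma normc_sum (s : seq X) (P : pred X) u :
  normc (\sum_(z <- s | P z) u z) <= \sum_(z <- s | P z) normc (u z).
Proof.
by rewrite -lecR rmorph_sum /=; exact: (@ler_norm_sum _ R[i]).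
Qed.

(** Convergence along inclusion tested against real [e] only: a positive complex
number is real. *)
Lemma has_sumP D u l : has_sum D u l <->
  forall e : R, 0 < e -> exists A0 : {fset X},
    forall A : {fset X}, (A0 `<=` A)%fset ->
    normc (l - \sum_(z <- A | z \in D) u z) <= e.
Proof.
rewrite /has_sum; split.
  move=> /cvgrPdist_le + e e0 => /(_ e%:C%C); rewrite ltcR => /(_ e0).
  move=> [A0 _ A0P]; exists A0 => A /A0P /=; by rewrite normcE_C lecR.
move=> ul; apply/cvgrPdist_le => e e0.
have eE : e = (complex.Re e)%:C%C by rewrite RRe_real// gtr0_real.
rewrite eE in e0 *; rewrite ltcR in e0.
have [A0 A0P] := ul _ e0.
by exists A0 => // A /A0P /=; rewrite normcE_C lecR.
Qed.

Lemma has_sumD D u v l m : has_sum D u l -> has_sum D v m ->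
  has_sum D (u \+ v) (l + m).
Proof.
rewrite /has_sum => ul vm.
rewrite (_ : (fun A : {fset X} => \sum_(z <- A | z \in D) (u \+ v) z) =
  (fun A : {fset X} => (\sum_(z <- A | z \in D) u z : R[i]^o) +
     \sum_(z <- A | z \in D) v z)).
  exact: cvgD ul vm.
by apply/funext => A; rewrite big_split.
Qed.

Lemma has_sumZ D u l (c : R[i]) : has_sum D u l ->
  has_sum D (fun z => c * u z) (c * l).
Proof.
rewrite /has_sum => ul.
rewrite (_ : (fun A : {fset X} => \sum_(z <- A | z \in D) (c * u z)) =
  (fun A : {fset X} => c *: (\sum_(z <- A | z \in D) u z : R[i]^o))).
  exact: cvgZl_tmp ul.
by apply/funext => A; rewrite scaler_sumr.
Qed.

Lemma eq_has_sum D u v l : {in D, u =1 v} -> has_sum D u l -> has_sum D v l.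
Proof.
move=> uv; rewrite /has_sum => ul.
rewrite (_ : (fun A : {fset X} => \sum_(z <- A | z \in D) v z) =
  (fun A : {fset X} => (\sum_(z <- A | z \in D) u z : R[i]^o))) //.
by apply/funext => A; apply: eq_bigr => z /uv ->.
Qed.

(** The supremum is approached by one finite sum, and nonnegative terms make all
larger finite sums at least as close. *)
Lemma has_sum_ge0 D (v : X -> R) : (forall z, D z -> 0 <= v z) ->
  (\esum_(z in D) (v z)%:E < +oo)%E ->
  has_sum D (fun z => (v z)%:C%C) (fine (\esum_(z in D) (v z)%:E))%:C%C.
Proof.
move=> v0 voo; set S := fine _.
have S_fin : (\esum_(z in D) (v z)%:E)%E \is a fin_num.
  by rewrite ge0_fin_numE// esum_ge0.
apply/has_sumP => e e0.
have [_ [Y [finY YD] <-] SY] := ub_ereal_sup_adherent e0 S_fin.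
have [A0 YE] := finite_fsetP.1 finY.
exists A0 => A A0A; rewrite -rmorph_sum -rmorphB normc_real.
have leS : \sum_(z <- A | z \in D) v z <= S.
  by rewrite -lee_fin fineK//; exact: esum_ge_fset.
have geS : S - e < \sum_(z <- A | z \in D) v z.
  rewrite -lte_fin EFinB fineK//; apply: lt_le_trans SY _.
  rewrite YE -fsbig_seq ?fset_uniq//= sumEFin lee_fin.
  rewrite [leLHS]big_seq big_mkcond /= (big_fset_incl _ A0A) => [|z _ /negPf->]//.
  rewrite [leRHS]big_mkcond; apply: ler_sum => z _.
  have [zA0|_] := boolP (z \in A0); last by case: ifP => // /set_mem/v0.
  by rewrite mem_set//; apply: YD; rewrite YE.
rewrite ler_norml; apply/andP; split; lra.
Qed.

Lemma has_sum_normc_le D u l (S : R) : has_sum D u l ->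
  (\esum_(z in D) (normc (u z))%:E <= S%:E)%E -> normc l <= S.
Proof.
move=> /has_sumP ul uS; apply/ler_addgt0Pr => e /ul[A0 /(_ _ (fsubset_refl _))].
set a := \sum_(z <- _ | _) _ => lA.
have -> : l = a + (l - a) by rewrite addrC subrK.
apply: le_trans (ler_normcD a (l - a)) _; apply: lerD lA.
rewrite -lee_fin; apply: le_trans uS.
apply: le_trans (esum_ge_fset D A0 _).
by rewrite lee_fin; exact: normc_sum.
Qed.

(** The real and imaginary parts split into positive and negative parts, each of
which is dominated by the norm. *)
Lemma has_sum_absolute D u : (\esum_(z in D) (normc (u z))%:E < +oo)%E ->
  exists l, has_sum D u l.
Proof.
move=> uoo.
have part (h : R[i] -> R) : (forall x, `|h x| <= normc x) ->
    exists l, has_sum D (fun z => (h (u z))%:C%C) l.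
  move=> hle.
  have ppos (k : R[i] -> R) : (forall x, 0 <= k x <= normc x) ->
      exists l, has_sum D (fun z => (k (u z))%:C%C) l.
    move=> kle; eexists; apply: has_sum_ge0 => [z _|].
      by case/andP: (kle (u z)).
    apply: le_lt_trans uoo; apply: le_esum => z _; rewrite lee_fin.
    by case/andP: (kle (u z)).
  have [l1 h1] : exists l, has_sum D (fun z => (Num.max (h (u z)) 0)%:C%C) l.
    apply: (ppos (fun x => Num.max (h x) 0)) => x; have := hle x.
    rewrite ler_norml => /andP[? ?].
    by case: (lerP _ 0) => ?; apply/andP; split; lra.
  have [l2 h2] : exists l, has_sum D (fun z => (Num.max (- h (u z)) 0)%:C%C) l.
    apply: (ppos (fun x => Num.max (- h x) 0)) => x; have := hle x.
    rewrite ler_norml => /andP[? ?].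
    by case: (lerP _ 0) => ?; apply/andP; split; lra.
  exists (l1 + (- 1) * l2).
  apply: eq_has_sum (has_sumD h1 (has_sumZ (c := -1) h2)) => z _ /=.
  rewrite mulN1r -rmorphB /=; congr (_%:C)%C.
  by case: (lerP (h (u z)) 0) => ?; case: lerP => ?; lra.
have Re_le (x : R[i]) : `|complex.Re x| <= normc x.
  case: x => a b; rewrite /normc /= -sqrtr_sqr ler_wsqrtr// lerDl; exact: sqr_ge0.
have Im_le (x : R[i]) : `|complex.Im x| <= normc x.
  case: x => a b; rewrite /normc /= -sqrtr_sqr ler_wsqrtr// lerDr; exact: sqr_ge0.
have [l1 h1] := part _ Re_le; have [l2 h2] := part _ Im_le.
exists (l1 + 'i%C * l2).
apply: eq_has_sum (has_sumD h1 (has_sumZ (c := 'i%C) h2)) => z _ /=.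
by rewrite [in RHS](complexE (u z)).
Qed.

End HasSum.

(** * Decomposition along a disjoint family in a weighted set *)

Section CalderonZygmund.
Variables (R : realType) (X : choiceType) (w : X -> R) (f : X -> R[i]).
Hypothesis w_gt0 : forall x, 0 < w x.

Lemma esum_weight_gt0 (Q : set X) x : Q x -> (0 < \esum_(z in Q) (w z)%:E)%E.
Proof.
move=> Qx; apply: (lt_le_trans (y := (w x)%:E)); first by rewrite lte_fin.
by apply: (le_esum_mem (a := fun z => (w z)%:E)) => // z; rewrite lee_fin ltW.
Qed.

(** The mean of [f] over [Q]. The second part is the triangle inequality
[|mean| mass(Q) <= \int_Q |f|], from which both the sup bound and the L^1 bound
on [g] follow. *)
Lemma exists_mean (Q : set X) : Q !=set0 ->
  (\esum_(z in Q) (w z)%:E < +oo)%E ->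
  (\esum_(z in Q) (normc (f z) * w z)%:E < +oo)%E ->
  exists c, has_sum Q (fun z => (f z - c) * (w z)%:C%C) 0 /\
    ((normc c)%:E * (\esum_(z in Q) (w z)%:E)
       <= \esum_(z in Q) (normc (f z) * w z)%:E)%E.
Proof.
move=> [x Qx] woo foo.
have wQ_fin : (\esum_(z in Q) (w z)%:E)%E \is a fin_num.
  by rewrite ge0_fin_numE// esum_ge0// => z _; rewrite lee_fin ltW.
have fQ_fin : (\esum_(z in Q) (normc (f z) * w z)%:E)%E \is a fin_num.
  rewrite ge0_fin_numE// esum_ge0// => z _.
  by rewrite lee_fin mulr_ge0 ?normc_ge0 ?ltW.
set m := fine (\esum_(z in Q) (w z)%:E).
have m_gt0 : 0 < m.
  by rewrite -lte_fin fineK//; exact: esum_weight_gt0 Qx.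
have fwE z : normc (f z * (w z)%:C%C) = normc (f z) * w z.
  by rewrite normcM normc_real gtr0_norm.
have [l fl] : exists l, has_sum Q (fun z => f z * (w z)%:C%C) l.
  by apply: has_sum_absolute; under eq_esum do rewrite fwE.
exists (l / m%:C%C); split.
  have := has_sum_ge0 (fun z _ => ltW (w_gt0 z)) woo.
  move=> /(has_sumZ (c := - (l / m%:C%C)))/(has_sumD fl).
  rewrite mulNr divfK ?subrr; last by rewrite -/m fmorph_eq0 gt_eqF.
  by apply: eq_has_sum => z _ /=; rewrite mulrBl mulNr.
rewrite normcM normcV normc_real gtr0_norm// -(fineK wQ_fin) -/m -EFinM.
rewrite divfK ?gt_eqF// -(fineK fQ_fin) lee_fin.
by apply: has_sum_normc_le fl _; rewrite fineK//; under eq_esum do rewrite fwE.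
Qed.

(** The part of the decomposition that uses no geometry: all that matters about
the family is that it consists of disjoint nonempty sets of finite mass, that
[|f|] has average at most [s] on each of them, and that [|f| <= s] off their
union. *)
Theorem calderon_zygmund (Qs : set (set X)) (s : R) :
  trivIset Qs id ->
  (\esum_(z in setT) (normc (f z) * w z)%:E < +oo)%E ->
  (forall Q, Qs Q -> [/\ Q !=set0, (\esum_(z in Q) (w z)%:E < +oo)%E &
    (\esum_(z in Q) (normc (f z) * w z)%:E
       <= s%:E * \esum_(z in Q) (w z)%:E)%E]) ->
  let Omega := \bigcup_(Q in Qs) Q in
  (forall z, ~ Omega z -> normc (f z) <= s) ->
  exists g b : X -> R[i],
    [/\ f = g \+ b, [set z | b z != 0] `<=` Omega,
        (forall z, normc (g z) <= s) /\
        (\esum_(z in setT) (normc (g z) * w z)%:E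
           <= \esum_(z in setT) (normc (f z) * w z)%:E)%E,
        forall Q, Qs Q -> has_sum Q (fun z => b z * (w z)%:C%C) 0 &
        (\esum_(Q in Qs) \esum_(z in Q) (normc (b z) * w z)%:E
           <= 2%:E * \esum_(z in setT) (normc (f z) * w z)%:E)%E].
Proof.
move=> Qs_triv foo QsP Omega f_le.
have nw_ge0 (h : X -> R[i]) z : (0 <= (normc (h z) * w z)%:E)%E.
  by rewrite lee_fin mulr_ge0 ?normc_ge0 ?ltW.
have sub_foo Q : (\esum_(z in Q) (normc (f z) * w z)%:E < +oo)%E.
  by apply: le_lt_trans foo; apply: esum_subset.
have /choice[c cP] Q : exists c, Qs Q ->
    [/\ has_sum Q (fun z => (f z - c) * (w z)%:C%C) 0, normc c <= s &
      (\esum_(z in Q) (normc c * w z)%:E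
         <= \esum_(z in Q) (normc (f z) * w z)%:E)%E].
  have [/QsP[Q0 woo fs]|] := pselect (Qs Q); last by exists 0.
  have [c [c0 c_le]] := exists_mean Q0 woo (sub_foo Q).
  exists c => _; split => //.
    move: Q0 => [x Qx].
    have wQ_gt0 : (0 < \esum_(z in Q) (w z)%:E)%E.
      exact: esum_weight_gt0 Qx.
    have wQ_fin : (\esum_(z in Q) (w z)%:E)%E \is a fin_num.
      by rewrite gt0_fin_numE.
    have := le_trans c_le fs; rewrite -(fineK wQ_fin) -!EFinM lee_fin ler_pM2r//.
    by rewrite -lte_fin fineK.
  by apply: le_trans c_le; apply: esumZ_le; exact: normc_ge0.
(* blk z is the member of the family that contains z; it is unique by
   disjointness (blkE), so g is the mean over Q on the whole of Q *)
have /choice[blk blkP] z : exists Q, Omega z -> Qs Q /\ Q z.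
  have [[Q QsQ Qz]|] := pselect (Omega z); last by exists set0.
  by exists Q.
have blkE Q z : Qs Q -> Q z -> blk z = Q.
  move=> QsQ Qz; have [QsB Bz] := blkP z (ex_intro2 _ _ Q QsQ Qz).
  by apply: Qs_triv => //; exists z.
pose g z := if z \in Omega then c (blk z) else f z.
have gQ Q z : Qs Q -> Q z -> g z = c Q.
  by move=> QsQ Qz; rewrite /g ifT ?(blkE Q)// inE; exists Q.
have gN z : ~ Omega z -> g z = f z by move=> Oz; rewrite /g ifF// memNset.
have sum_Omega (h : X -> R[i]) :
    (\esum_(Q in Qs) \esum_(z in Q) (normc (h z) * w z)%:E
     = \esum_(z in Omega) (normc (h z) * w z)%:E)%E.
  by rewrite -(@esum_trivIset _ _ _ Qs id).
have sum_g : (\esum_(z in setT) (normc (g z) * w z)%:E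
           <= \esum_(z in setT) (normc (f z) * w z)%:E)%E.
  rewrite (esumID Omega)// [leRHS](esumID Omega)// !setTI; apply: leeD.
    rewrite -!sum_Omega; apply: le_esum => Q QsQ.
    have [_ _ c_le] := cP Q QsQ; apply: le_trans c_le; apply: le_esum => z Qz.
    by rewrite (gQ Q).
  by apply: le_esum => z Oz; rewrite gN.
exists g, (f \- g); split.
- by apply/funext => z /=; rewrite addrC subrK.
- move=> z /=; apply: contraPP => /gN ->.
  by rewrite subrr eqxx.
- split=> // z; have [[Q QsQ Qz]|Oz] := pselect (Omega z).
    by rewrite (gQ Q)//; have [] := cP Q QsQ.
  by rewrite gN// f_le.
- move=> Q QsQ; have [+ _ _] := cP Q QsQ; apply: eq_has_sum => z /set_mem Qz /=.
  by rewrite (gQ Q).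
- rewrite sum_Omega; apply: le_trans (esum_subset (@subsetT _ _) _) _ => //.
  apply: (@le_trans _ _ (\esum_(z in setT)
    ((normc (f z) * w z)%:E + (normc (g z) * w z)%:E))%E).
    apply: le_esum => z _; rewrite -EFinD lee_fin -mulrDl.
    apply: ler_wpM2r; first exact: ltW.
    by apply: le_trans (ler_normcD _ _) _; rewrite (normcN (g z)).
  by rewrite esumD// mule_natl mule2n leeD2l.
Qed.
End CalderonZygmund.

(** * Root paths and sectors in a tree *)

(** The cycle goes out along the first path and back along the second one, which
meets the first only at [x] and [y]. *)
Lemma diverging_paths_cycle (X : choiceType) (adj : rel X) x y s s' :
  symmetric adj -> path adj x (rcons s y) -> path adj x (rcons s' y) ->
  uniq (x :: rcons s y) -> uniq (x :: rcons s' y) -> ~~ has [in s'] s ->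
  ucycle adj (x :: rcons s y ++ rev s').
Proof.
move=> adjC xs xs' us us' ss'; apply/andP; split.
  rewrite /= rcons_cat cat_path xs last_rcons -rev_cons.
  have -> : x :: s' = belast x (rcons s' y) by rewrite belast_rcons.
  rewrite -[X in path _ X](last_rcons x s' y) rev_path.
  by under eq_path do rewrite adjC.
rewrite -cat_cons cat_uniq us rev_uniq has_rev.
move: us'; rewrite /= rcons_uniq mem_rcons inE negb_or.
move=> /and3P[/andP[xy xs''] ys' ->]; rewrite andbT.
apply/hasPn => z zs' /=; rewrite -rcons_cons mem_rcons !inE !negb_or.
rewrite (memPn ys' _ zs') (memPn xs'' _ zs') /=.
by apply: contra ss' => zs; apply/hasP; exists z.
Qed.

(** Strip the common beginning of the two paths; if they then leave [x] by
different edges, they meet again at the latest at their common end, which closes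
a cycle of at least three vertices. *)
Lemma simple_path_unique (X : choiceType) (adj : rel X) :
  symmetric adj -> (forall c : seq X, ucycle adj c -> (size c <= 2)%N) ->
  forall x p p', path adj x p -> path adj x p' ->
    uniq (x :: p) -> uniq (x :: p') -> last x p = last x p' -> p = p'.
Proof.
move=> adjC acyclic x p; elim: p x => [|a p IHp] x [|b p'] //.
- move=> _ _ _ /andP[xp' _] xE.
  by have := mem_last b p'; rewrite -[last b p']xE (negbTE xp').
- move=> _ _ /andP[xp _] _ xE.
  by have := mem_last a p; rewrite [last a p]xE (negbTE xp).
have [<-{b}|ab] := eqVneq a b.
  move=> /andP[_ pa] /andP[_ pb] /andP[_ up] /andP[_ up'] lastE.
  by congr (_ :: _); apply: IHp lastE.
move=> xap xbp' uap ubp' lastE; exfalso.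
have hasy : has [in b :: p'] (a :: p).
  apply/hasP; exists (last a p); first exact: mem_last.
  rewrite [last a p]lastE; exact: (mem_last b p').
move: {IHp lastE} hasy uap xap xbp' ubp'.
have : head x (a :: p) != head x (b :: p') by [].
move: (a :: p) (b :: p') => s s' + hasy; case/split_find: hasy.
(* y is the first vertex of the first path that lies on the second one *)
move=> y s1 s2 ys'; case/splitPr: ys' => s1' s2'.
rewrite -?cat_rcons -?cat_cons !cat_uniq !cat_path.
move=> s1s' hd /andP[us _] /andP[ps _] /andP[ps' _] /andP[us' _].
have s1s1' : ~~ has [in s1'] s1.
  apply: contra s1s'; apply: sub_has => z /= zs.
  by rewrite mem_cat mem_rcons inE zs orbT.
have := acyclic _ (diverging_paths_cycle adjC ps ps' us us' s1s1').
rewrite /= size_cat size_rcons size_rev.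
case: s1 s1' hd {us ps us' ps' s1s' s1s1'} => [|? ?] [|? ?]//=;
  by rewrite ?eqxx//; lia.
Qed.

(** In a tree exactly one list qualifies, so the default value never occurs. *)
Definition rootpath (X : choiceType) (adj : rel X) (o x : X) : seq X :=
  xget [::] [set p | [/\ path adj o p, last o p = x & uniq (o :: p)]].

Section RootedTree.
Variables (q : nat) (X : choiceType) (adj : rel X) (o : X).
Hypothesis treeX : homogeneous_tree q adj.

Let adjC : symmetric adj := adj_sym treeX.
Local Notation rp := (rootpath adj o).

Lemma rootpathP x : [/\ path adj o (rp x), last o (rp x) = x & uniq (o :: rp x)].
Proof.
have [p pp px] := adj_connected treeX o x.
pose P p := [/\ path adj o p, last o p = x & uniq (o :: p)].
suff : P (rp x) by [].
case/shortenP: pp px => p' pp' up' _ px.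
exact: (@xgetI _ _ P p').
Qed.

Lemma rootpath_uniq p : path adj o p -> uniq (o :: p) -> rp (last o p) = p.
Proof.
move=> pp up; have [qp ql qu] := rootpathP (last o p).
exact: simple_path_unique adjC (adj_acyclic treeX) _ _ _ qp pp qu up ql.
Qed.

Lemma rootpath_inj : injective rp.
Proof.
move=> x y xy; have [_ <- _] := rootpathP x; have [_ <- _] := rootpathP y.
by rewrite xy.
Qed.

Lemma mem_rootpath x : x \in o :: rp x.
Proof.
by have [_ lp _] := rootpathP x; have := mem_last o (rp x); rewrite lp.
Qed.

Lemma rootpath0 : rp o = [::].
Proof. exact: (rootpath_uniq (p := [::])). Qed.

Lemma gdist_rootpath x : gdist adj o x = size (rp x).
Proof.
have [pp pl pu] := rootpathP x.
apply: xget_unique => /=; first split.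
- by exists (rp x).
- move=> _ [p [+ + <-]] => /shortenP[p' pp' pu' sub lp].
  rewrite -lp rootpath_uniq //; apply: uniq_leq_size sub.
  by case/andP: pu'.
- move=> n [[p [pp' pl' <-]] ln]; apply/eqP; rewrite eqn_leq.
  apply/andP; split; first by apply: ln; exists (rp x).
  case/shortenP: pp' pl' {ln} => p' pp' pu' sub lp'.
  rewrite -lp' rootpath_uniq //; apply: uniq_leq_size sub.
  by case/andP: pu'.
Qed.

Lemma segmentE x : segment adj o x = [set` o :: rp x].
Proof.
apply/seteqP; split=> [z [p [pp pl pu zp]]|z zx] /=.
  by rewrite -pl rootpath_uniq.
by have [? ? ?] := rootpathP x; exists (rp x).
Qed.

(** Cutting the simple path to [x] at [u] leaves the simple path to [u]. *)
Lemma rootpath_prefix u x : u \in o :: rp x -> exists s, rp x = rp u ++ s.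
Proof.
have [+ _ +] := rootpathP x.
move: (rp x) => p pp up up'; case/splitPl: up' pp up => p1 p2 lp.
rewrite cat_path -cat_cons cat_uniq => /andP[pp _] /andP[up _].
by exists p2; rewrite -lp rootpath_uniq.
Qed.

Lemma rootpath_sub u x : u \in o :: rp x -> {subset o :: rp u <= o :: rp x}.
Proof.
move=> /rootpath_prefix[s ->] z; rewrite !inE mem_cat.
by case/orP => ->; rewrite ?orbT.
Qed.

Lemma sectorE u : sector adj o u = [set x | u \in o :: rp x].
Proof.
apply/seteqP; split => x; rewrite /sector /= !segmentE.
  by apply; exact: mem_rootpath.
exact: rootpath_sub.
Qed.

Lemma sector_origin : sector adj o o = setT.
Proof. by rewrite sectorE; apply/seteqP; split => // x _; exact: mem_head. Qed.

Lemma sector_self u : sector adj o u u.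
Proof. by rewrite sectorE; exact: mem_rootpath. Qed.

Lemma sector_sub u v : sector adj o u v -> sector adj o v `<=` sector adj o u.
Proof. by rewrite !sectorE => /= uv x /rootpath_sub; apply. Qed.

(** The root paths of [u] and [v] are initial parts of that of [x], so the
shorter is an initial part of the longer. *)
Lemma sector_meet u v x : sector adj o u x -> sector adj o v x ->
  (size (rp u) <= size (rp v))%N -> sector adj o u v.
Proof.
rewrite !sectorE /= => /rootpath_prefix[s xs] /rootpath_prefix[r xr] uv.
have /eqP := xr; rewrite xs => /eqP/(congr1 (take (size (rp v)))).
rewrite (@take_size_cat _ _ (rp v)) // take_cat ltnNge uv /= => <-.
have := mem_rootpath u; rewrite !inE mem_cat.
by case/orP => ->; rewrite ?orbT.
Qed.

(** [v] is a neighbour of [u] one step further from [o]. In terms of root paths,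
both the weight ratio and the nesting of sectors are immediate. *)
Definition is_child u v := rp v = rcons (rp u) v.

Lemma child_sector u v x : is_child u v -> sector adj o v x -> sector adj o u x.
Proof.
move=> uv; apply: sector_sub; rewrite sectorE /= uv.
by have := mem_rootpath u; rewrite !inE mem_rcons inE => /orP[]->; rewrite ?orbT.
Qed.

Lemma parent_exists u : u != o -> exists2 v, is_child v u & adj v u.
Proof.
move=> uo; have [pp lp up] := rootpathP u.
case/lastP pE : (rp u) => [|p v].
  by move: lp uo; rewrite pE /= => ->; rewrite eqxx.
move: lp up pp; rewrite pE last_rcons => vu; subst v.
rewrite -rcons_cons rcons_uniq rcons_path => /andP[_ up] /andP[pp adjp].
by exists (last o p) => //; rewrite /is_child (rootpath_uniq pp up) pE.
Qed.

(** The child is the vertex that follows [u] on the root path of [x]. *)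
Lemma sector_step u x : sector adj o u x -> x <> u ->
  exists v, [/\ adj u v, is_child u v & sector adj o v x].
Proof.
rewrite sectorE /= => ux xu; have [[|v s] xs] := rootpath_prefix ux.
  by case: xu; apply: rootpath_inj; rewrite xs cats0.
have [pp lp up] := rootpathP x; have [_ lu _] := rootpathP u.
move: pp up; rewrite xs -cat_rcons -cat_cons cat_uniq cat_path rcons_path lu.
move=> /andP[/andP[pu uv] _] /andP[uu _].
have vE : is_child u v.
  rewrite /is_child -[in LHS](last_rcons o (rp u) v) rootpath_uniq //.
  by rewrite rcons_path pu lu.
exists v; split => //; rewrite sectorE /= xs !inE mem_cat inE eqxx orbT.
by rewrite orbT.
Qed.

(** Of the [q + 1] neighbours of [u], one is its parent unless [u = o]. *)
Lemma childrenP u : exists s : seq X,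
  [/\ (size s <= q + (u == o))%N, forall v, v \in s -> is_child u v &
      forall x, sector adj o u x -> x <> u ->
        exists2 v, v \in s & sector adj o v x].
Proof.
have nbr := adj_regular treeX u.
have [N NE] : exists N : {fset X}, [set y | adj u y] = [set` N].
  by apply/finite_fsetP; exists q.+1.
rewrite NE in nbr; have sN := card_eq_fsetP nbr.
have memN v : (v \in N) = adj u v.
  have /seteqP[NE1 NE2] := NE.
  by apply/idP/idP; [exact: NE2|exact: NE1].
exists [seq v <- N | `[< is_child u v >]]; split.
- have := count_predC (fun v => `[< is_child u v >]) N.
  rewrite size_filter [size _]sN; have [->|uo] := eqVneq u o; first lia.
  have [v vu adjvu] := parent_exists uo.
  suff : has (predC (fun v => `[< is_child u v >])) N by rewrite has_count; lia.
  apply/hasP; exists v; first by rewrite memN adjC.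
  apply/asboolPn => /(congr1 size); rewrite vu !size_rcons; lia.
- by move=> v; rewrite mem_filter => /andP[/asboolP].
- move=> x ux xu; have [v [uv vc vx]] := sector_step ux xu.
  by exists v => //; rewrite mem_filter memN uv andbT; exact/asboolP.
Qed.
End RootedTree.

(** * The mass of a sector *)

Section Mass.
Variables (R : realType) (q : nat) (alpha : R).
Hypotheses (hq : (2 <= q)%N) (halpha : 1 < alpha).

(** The ratio of the weights of a vertex and of its parent. *)
Definition weight_ratio : R := q%:R `^ (- alpha).

Let q_gt0 : 0 < q%:R :> R. Proof. by rewrite ltr0n (ltn_trans _ hq). Qed.

Lemma weight_ratio_gt0 : 0 < weight_ratio. Proof. exact: powR_gt0. Qed.

Lemma q_weight_ratio_lt1 : q%:R * weight_ratio < 1.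
Proof.
rewrite /weight_ratio powRN ltr_pdivrMr ?powR_gt0// mul1r.
rewrite /powR gt_eqF// -[ltLHS]lnK ?posrE// ltr_expR ltr_pMl//.
by rewrite ln_gt0// ltr1n.
Qed.

Lemma weight_ratio_lt1 : weight_ratio < 1.
Proof.
apply: le_lt_trans q_weight_ratio_lt1.
apply: ler_peMl; first exact: ltW weight_ratio_gt0.
by rewrite ler1n; lia.
Qed.

(** The sum of the geometric series of ratio [q * weight_ratio]: the mass of a
sector other than the whole tree, relative to the weight of its root. *)
Definition sector_const : R := (1 - q%:R * weight_ratio)^-1.

(** Makes the bound [sector_const] reproduce itself from one generation to the
next. *)
Lemma sector_constE : 1 + q%:R * weight_ratio * sector_const = sector_const.
Proof.
have := q_weight_ratio_lt1; rewrite /sector_const => ?.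
by field; lra.
Qed.

Lemma sector_const_ge1 : 1 <= sector_const.
Proof.
rewrite /sector_const invf_ge1 ?subr_gt0 ?q_weight_ratio_lt1//.
by rewrite gerBl mulr_ge0// ltW// weight_ratio_gt0.
Qed.

Variables (X : choiceType) (adj : rel X) (o : X).
Hypothesis treeX : homogeneous_tree q adj.
Local Notation rp := (rootpath adj o).
Local Notation w := (weight q alpha adj o).
Local Notation K := sector_const.

Lemma weight_gt0 x : 0 < w x. Proof. exact: powR_gt0. Qed.

Lemma weight_child u v : is_child adj o u v -> w v = weight_ratio * w u.
Proof.
move=> uv; rewrite /weight !(gdist_rootpath _ treeX) uv size_rcons /weight_ratio.
rewrite -powRD; last by rewrite (gt_eqF q_gt0) implybT.
by congr (_ `^ _); rewrite -natr1; ring.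
Qed.

(** Sectors cut after [n] generations, so that their masses can be bounded by
induction on [n]. *)
Definition sector_upto n u : set X :=
  sector adj o u `&` [set x | (size (rp x) < size (rp u) + n)%N].

Let w_ge0 x : (0 <= (w x)%:E)%E. Proof. by rewrite lee_fin ltW ?weight_gt0. Qed.

Lemma sector_upto0 u : sector_upto 0 u = set0.
Proof.
apply/seteqP; split=> // x [] /=; rewrite (sectorE _ treeX) /=.
by move=> /(rootpath_prefix treeX)[s ->]; rewrite size_cat; lia.
Qed.

Lemma sector_upto_step n u (c : R) : 0 <= c ->
  (forall v, is_child adj o u v ->
    (\esum_(x in sector_upto n v) (w x)%:E <= (c * w v)%:E)%E) ->
  (\esum_(x in sector_upto n.+1 u) (w x)%:E
     <= ((1 + (q + (u == o))%:R * weight_ratio * c) * w u)%:E)%E.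
Proof.
move=> c_ge0 le_c; have [s [sq s_child s_cover]] := childrenP o treeX u.
apply: (@le_trans _ _
    ((w u)%:E + \sum_(v <- s) \esum_(x in sector_upto n v) (w x)%:E)%E).
  (* the vertex u itself, indexed by None, and the sectors of its children *)
  pose J i := if i is Some v then sector_upto n v else [set u].
  rewrite -(esum_set1 (a := fun x => (w x)%:E))//.
  have := @esum_cover_le R _ _ (None :: map Some s) J (sector_upto n.+1 u)
    (fun x => (w x)%:E).
  rewrite big_cons big_map; apply => // x [ux xn].
  have [->|/eqP xu] := eqVneq x u; first by exists None; rewrite ?mem_head.
  have [v vs vx] := s_cover x ux xu; exists (Some v).
    by rewrite inE (mem_map Some_inj) vs.
  by split => //=; move: xn; rewrite /= (s_child v vs) size_rcons; lia.
apply: (@le_trans _ _ ((w u)%:E + \sum_(v <- s) (c * weight_ratio * w u)%:E)%E).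
  rewrite leeD2l// big_seq [leRHS]big_seq; apply: lee_sum => v /s_child uv.
  by rewrite -mulrA -(weight_child uv); exact: le_c.
rewrite sumEFin -EFinD lee_fin big_const_seq count_predT iter_addr_0.
rewrite -[_ *+ size s]mulr_natr.
rewrite [leLHS](_ : _ = (1 + (size s)%:R * weight_ratio * c) * w u); last by ring.
rewrite ler_pM2r ?weight_gt0// lerD2l -!mulrA.
by apply: ler_wpM2r; rewrite ?ler_nat// mulr_ge0// ltW ?weight_ratio_gt0.
Qed.

Lemma sector_upto_mass n u : u != o ->
  (\esum_(x in sector_upto n u) (w x)%:E <= (K * w u)%:E)%E.
Proof.
have K_ge0 : 0 <= K by apply: le_trans sector_const_ge1.
elim: n u => [|n IHn] u uo.
  by rewrite sector_upto0 esum_set0 lee_fin mulr_ge0// ltW ?weight_gt0.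
have := @sector_upto_step n u K K_ge0; rewrite (negPf uo) addn0 sector_constE; apply.
move=> v uv; apply: IHn; apply: contra_eq_neq uv => ->.
by rewrite /is_child (rootpath0 _ treeX); case: (rp u).
Qed.

(** A sum over a sector is a supremum of finite sums, and a finite set reaches
only finitely many generations. *)
Lemma sector_mass_le (c : R) u :
  (forall n, (\esum_(x in sector_upto n u) (w x)%:E <= c%:E)%E) ->
  (\esum_(x in sector adj o u) (w x)%:E <= c%:E)%E.
Proof.
move=> le_c; apply: ge_ereal_sup => _ [Y [finY Yu] <-].
have [Z YZ] := finite_fsetP.1 finY.
pose n := (\max_(x <- Z) size (rp x)).+1.
apply: le_trans (le_c n); apply: esum_ge; exists Y => //; split => // x Yx.
split; first exact: Yu.
rewrite /= /n addnS ltnS; apply: leq_trans (leq_addl _ _).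
by apply: leq_bigmax_seq => //; move: Yx; rewrite YZ.
Qed.

(** The origin has one child more than the other vertices, which at most doubles
the constant. *)
Lemma sector_mass u : (\esum_(x in sector adj o u) (w x)%:E <= (2 * K * w u)%:E)%E.
Proof.
have K_ge1 := sector_const_ge1.
have r_gt0 := weight_ratio_gt0; have r_lt1 := weight_ratio_lt1.
have K_ge0 : 0 <= K by apply: le_trans K_ge1.
apply: sector_mass_le => n.
have [->|uo] := eqVneq u o; last first.
  apply: le_trans (sector_upto_mass n uo) _.
  by rewrite lee_fin ler_pM2r ?weight_gt0//; lra.
case: n => [|n].
  by rewrite sector_upto0 esum_set0 lee_fin !mulr_ge0// ltW ?weight_gt0.
apply: le_trans (sector_upto_step K_ge0 _) _ => [v ov|].
  apply: sector_upto_mass; apply: contra_eq_neq ov => ->.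
  by rewrite /is_child (rootpath0 _ treeX).
rewrite lee_fin ler_pM2r ?weight_gt0// eqxx natrD.
have rK : weight_ratio * K <= K by rewrite ler_piMl// ltW.
by rewrite mulr1n !mulrDl mul1r; have := sector_constE; lra.
Qed.

End Mass.

(** * Weighted norms *)

Section Norms.
Variables (R : realType) (q : nat) (alpha : R).
Hypothesis hq : (2 <= q)%N.
Variables (X : choiceType) (adj : rel X) (o : X).
Local Notation w := (weight q alpha adj o).

Lemma Lp_norm1E f :
  Lp_norm q alpha adj o 1 f = \esum_(x in setT) (normc (f x) * w x)%:E.
Proof.
rewrite /Lp_norm invr1 poweRe1.
  by apply: eq_esum => x _; rewrite powRr1// normc_ge0.
by apply: esum_ge0 => x _; rewrite lee_fin mulr_ge0 ?powR_ge0.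
Qed.

Lemma Lp_norm1_part (b : X -> R[i]) (Q : set X) :
  Lp_norm q alpha adj o 1 (b \* \1_Q) = \esum_(x in Q) (normc (b x) * w x)%:E.
Proof.
rewrite Lp_norm1E [RHS]esum_mkcond; apply: eq_esum => x _ /=.
by rewrite indicE; case: (x \in Q); rewrite ?mulr1// mulr0 normc0 mul0r.
Qed.

Lemma Lp_norm2_sqr_le (g : X -> R[i]) (s : R) : 0 <= s ->
  (forall x, normc (g x) <= s) ->
  (Lp_norm q alpha adj o 2 g ^+ 2 <= s%:E * Lp_norm q alpha adj o 1 g)%E.
Proof.
move=> s0 gs; rewrite Lp_norm1E /Lp_norm poweR12_sqrt.
  rewrite sqr_sqrte.
    apply: le_trans (esumZ_le _ _ s0); apply: le_esum => x _.
    rewrite lee_fin powR_mulrn ?normc_ge0// expr2 mulrA.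
    by apply: ler_wpM2r; rewrite ?powR_ge0// ler_wpM2r ?normc_ge0.
  by apply: esum_ge0 => x _; rewrite lee_fin mulr_ge0 ?powR_ge0.
by apply: esum_ge0 => x _; rewrite lee_fin mulr_ge0 ?powR_ge0.
Qed.

(** The hypothesis on [t] without the division: the average of [|f|] over the
whole tree is less than [t]. *)
Lemma average_lt f t : in_Lp q alpha adj o 1 f ->
  (mu q alpha adj o setT < +oo)%E ->
  (Lp_norm q alpha adj o 1 f / mu q alpha adj o setT < t%:E)%E ->
  0 < t /\
  (Lp_norm q alpha adj o 1 f < t%:E * mu q alpha adj o setT)%E.
Proof.
rewrite /in_Lp Lp_norm1E => foo muoo.
have mu_gt0 : (0 < mu q alpha adj o setT)%E.
  by apply: (esum_weight_gt0 _ (x := o)) => // x; exact: weight_gt0.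
have f_ge0 : (0 <= \esum_(x in setT) (normc (f x) * w x)%:E)%E.
  by apply: esum_ge0 => x _; rewrite lee_fin mulr_ge0 ?normc_ge0 ?powR_ge0.
rewrite -(@fineK _ (mu _ _ _ _ _)); last by rewrite gt0_fin_numE.
rewrite -(@fineK _ (esum _ _)); last by rewrite ge0_fin_numE.
set m := fine _; set n := fine (mu _ _ _ _ _).
have n_gt0 : 0 < n by rewrite fine_gt0// mu_gt0.
rewrite inver gt_eqF// -!EFinM !lte_fin ltr_pdivrMr// => mt.
split => //; rewrite -(pmulr_lgt0 _ n_gt0); apply: le_lt_trans mt.
exact: fine_ge0.
Qed.
End Norms.

(** * The stopping family *)

Section Stopping.
Variables (q : nat) (X : choiceType) (adj : rel X) (o : X).
Hypothesis treeX : homogeneous_tree q adj.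
Variables (heavy large : set X).
Local Notation sector := (sector adj o).
Local Notation rp := (rootpath adj o).

(** The sectors of these vertices are the maximal ones among those of heavy
vertices. *)
Definition first_heavy u := heavy u /\ forall v, sector v u -> heavy v -> v = u.

Definition stopping_family : set (set X) :=
  [set A | exists2 u, A = sector u & first_heavy u] `|`
  [set A | exists u,
     [/\ A = [set u], large u & forall v, sector v u -> ~ heavy v]].

(** Of two sectors that meet, one contains the other, so first heavy vertices
with meeting sectors agree. *)
Lemma stopping_family_trivIset : trivIset stopping_family id.
Proof.
have meet u v x : first_heavy u -> first_heavy v -> sector u x -> sector v x ->
    (size (rp u) <= size (rp v))%N -> u = v.
  move=> [hu _] [_ fv] ux vx uv; exact: fv (sector_meet treeX ux vx uv) hu.
move=> A B [[u -> fu]|[u [-> _ nu]]] [[v -> fv]|[v [-> _ nv]]] [x []] /=.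
- move=> ux vx; suff -> : u = v by [].
  have /orP[uv|vu] := leq_total (size (rp u)) (size (rp v)).
    exact: meet fu fv ux vx uv.
  by apply/esym; exact: meet fv fu vx ux vu.
- by move=> ux xv; subst x; case: (nv _ ux fu.1).
- by move=> xu vx; subst x; case: (nu _ vx fv.1).
- by move=> -> ->.
Qed.

Lemma first_heavy_exists u x : sector u x -> heavy u ->
  exists2 v, sector v x & first_heavy v.
Proof.
move=> ux hu.
pose P n := `[< exists v, [/\ sector v x, heavy v & size (rp v) = n] >].
have exP : exists n, P n by exists (size (rp u)); apply/asboolP; exists u.
have [n /asboolP[v [vx hv <-]] vmin] := ex_minnP exP.
exists v => //; split => // v' v'v hv'.
have v'x : sector v' x by exact: (sector_sub treeX v'v).
have vv' : (size (rp v) <= size (rp v'))%N.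
  by apply: vmin; apply/asboolP; exists v'.
have := sector_meet treeX vx v'x vv'; move: v'v; rewrite !(sectorE o treeX) /=.
move=> /(rootpath_prefix treeX)[s vE] _.
apply: (rootpath_inj treeX (o := o)); rewrite vE (_ : s = [::]) ?cats0//.
by apply: size0nil; move: vv'; rewrite vE size_cat; lia.
Qed.

Lemma stopping_familyN x : ~ (\bigcup_(A in stopping_family) A) x ->
  ~ large x /\ forall v, sector v x -> ~ heavy v.
Proof.
move=> nx; have nh v : sector v x -> ~ heavy v.
  move=> vx hv; have [u ux fu] := first_heavy_exists vx hv.
  by apply: nx; exists (sector u) => //; left; exists u.
by split=> // lx; apply: nx; exists [set x] => //; right; exists x.
Qed.
End Stopping.

(** * The decomposition *)

Theorem proposition30 (R : realType) (q : nat) (alpha : R)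
    (hq : (2 <= q)%N) (halpha : 1 < alpha) :
  exists2 C : R, 0 < C &
  forall (X : choiceType) (adj : rel X) (o : X), homogeneous_tree q adj ->
  forall (f : X -> R[i]) (t : R), in_Lp q alpha adj o 1 f ->
  (Lp_norm q alpha adj o 1 f / mu q alpha adj o [set: X] < t%:E)%E ->
  exists Qs Fs : set (set X),
    [/\ trivIset Qs id, trivIset Fs id,
        forall A, Qs A -> singleton_or_sector adj o A &
        forall A, Fs A -> singleton_or_sector adj o A] /\
    let Omega := \bigcup_(A in Qs) A in
    let F := \bigcup_(A in Fs) A in
    [/\ Omega `|` F = [set: X] /\ Omega `&` F = set0,
        forall z, F z -> Normc.normc (f z) <= t &
        exists g b : X -> R[i],
          let part (Q : set X) : X -> R[i] := b \* \1_Q in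
          [/\ f = g \+ b,
              [set x | b x != 0] `<=` Omega,
              (Lp_norm q alpha adj o 2 g ^+ 2
                 <= (C * t)%:E * Lp_norm q alpha adj o 1 f)%E,
              forall Q, Qs Q ->
                has_sum Q
                  (fun z => part Q z * (weight q alpha adj o z)%:C%C) 0 &
              (\esum_(Q in Qs) Lp_norm q alpha adj o 1 (part Q)
                 <= C%:E * Lp_norm q alpha adj o 1 f)%E]].
Proof.
set K := sector_const q alpha; set r := weight_ratio q alpha.
have r_gt0 : 0 < r := weight_ratio_gt0 alpha hq.
have r_lt1 : r < 1 := weight_ratio_lt1 hq halpha.
have K_ge1 : 1 <= K := sector_const_ge1 hq halpha.
(* bounds the mass of a sector by that of each of its pieces *)
pose D := 2 * K / r.
have KD : 2 * K <= D by rewrite /D ler_pdivlMr// ler_piMr ?ltW//; lra.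
have D_ge2 : 2 <= D by lra.
exists D => [|X adj o treeX f t fL1]; first lra.
pose w := weight q alpha adj o.
have w_gt0 : forall x, 0 < w x := weight_gt0 alpha hq adj o.
have self u : sector adj o u u := @sector_self _ _ _ _ treeX u.
pose mass A := (\esum_(z in A) (w z)%:E)%E.
pose fmass A := (\esum_(z in A) (normc (f z) * w z)%:E)%E.
have fmass_sub A B : A `<=` B -> (fmass A <= fmass B)%E.
  move=> AB; apply: esum_subset => // z.
  by rewrite lee_fin mulr_ge0 ?normc_ge0 ?ltW.
have mass_le u : (mass (sector adj o u) <= (2 * K * w u)%:E)%E.
  exact: sector_mass.
have mass_lty u : (mass (sector adj o u) < +oo)%E.
  by apply: le_lt_trans (mass_le u) _; rewrite ltry.
have le_mass u A : A u -> ((w u)%:E <= mass A)%E.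
  move=> Au; apply: (le_esum_mem (a := fun z => (w z)%:E)) => // z.
  by rewrite lee_fin ltW.
move=> /(average_lt hq fL1)[|t_gt0 f_lt].
  by rewrite -(sector_origin o treeX); exact: mass_lty.
pose heavy : set X :=
  [set u | (t%:E * mass (sector adj o u) < fmass (sector adj o u))%E].
pose large : set X := [set u | t < normc (f u)].
have not_heavy_o : ~ heavy o.
  rewrite /heavy /= (sector_origin o treeX) => /(lt_trans f_lt).
  by rewrite Lp_norm1E ltxx.
have heavy_neq_o u : heavy u -> u != o.
  by apply: contraPneq => ->.
have not_heavyP u : ~ heavy u ->
    (fmass (sector adj o u) <= (t * (2 * K * w u))%:E)%E.
  move=> /negP; rewrite -leNgt => /le_trans; apply.
  by rewrite EFinM lee_wpmul2l// lee_fin ltW.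
pose Qs := stopping_family adj o heavy large.
pose Omega := \bigcup_(A in Qs) A.
have fOmega z : ~ Omega z -> normc (f z) <= t.
  by move=> /(stopping_familyN treeX)[/negP]; rewrite -leNgt.
have QsP Q : Qs Q ->
    [/\ Q !=set0, (mass Q < +oo)%E & (fmass Q <= (D * t)%:E * mass Q)%E].
  have D_t_ge0 : 0 <= D * t by rewrite mulr_ge0 ?ltW//; lra.
  (* c stands for the weight of the root of the smallest sector containing A
     properly: the parent of u if A = T_u, and u itself if A = {u} *)
  have Dmass u A (c : R) : A u ->
      (fmass A <= (t * (2 * K * c))%:E)%E -> r * c <= w u ->
      (fmass A <= (D * t)%:E * mass A)%E.
    move=> Au /le_trans le_c rc; apply: le_c.
    apply: le_trans (lee_wpmul2l _ (le_mass u A Au)); last by rewrite lee_fin.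
    rewrite -EFinM lee_fin (_ : t * _ = D * t * (r * c)); last first.
      by rewrite /D; field; rewrite gt_eqF.
    exact: ler_wpM2l.
  move=> [[u -> [hu fu]]|[u [-> _ nu]]].
    split; [by exists u; exact: self|exact: mass_lty|].
    have [p pu _] := parent_exists treeX (heavy_neq_o u hu).
    have pu_sector : sector adj o p u.
      by apply: (child_sector treeX pu); exact: self.
    have np : ~ heavy p.
      move=> hp; have pE := fu _ pu_sector hp.
      move: pu; rewrite /is_child pE => /(congr1 size).
      by rewrite size_rcons; lia.
    apply: (Dmass u _ (w p)); first exact: self.
      apply: le_trans (not_heavyP _ np); apply: fmass_sub.
      exact: (sector_sub treeX pu_sector).
    by rewrite -(weight_child alpha hq treeX pu).
  split; first by exists u.
    apply: le_lt_trans (mass_lty u); apply: esum_subset => [_ -> //|z].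
    by rewrite lee_fin ltW.
  apply: (Dmass u _ (w u)) => //.
    by apply: le_trans (not_heavyP _ (nu u (self u))); apply: fmass_sub => _ ->.
  by rewrite ler_piMl ?ltW.
have fmass_fin : (fmass setT < +oo)%E by move: fL1; rewrite /in_Lp Lp_norm1E.
have Qs_triv : trivIset Qs id.
  exact: (@stopping_family_trivIset _ _ _ _ treeX).
have [|g [b [fgb bOmega [g_le g_int] b_mean b_int]]] :=
  calderon_zygmund w_gt0 Qs_triv fmass_fin QsP.
  by move=> z /fOmega /le_trans; apply; rewrite ler_peMl ?ltW//; lra.
exists Qs, [set A | exists2 z, ~ Omega z & A = [set z]]; split.
  split => //.
  - by move=> A B [u _ ->] [v _ ->] [x [/= -> ->]].
  - move=> A [[u -> [hu _]]|[u [-> _ _]]]; [right|left]; exists u => //.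
    exact: heavy_neq_o.
  - by move=> A [z _ ->]; left; exists z.
move=> Omega' F.
have FE : F = ~` Omega.
  apply/seteqP; split=> [z [_ [u nu ->] ->] //|z nz].
  by exists [set z] => //; exists z.
split; first by rewrite FE setUv setICr.
  by rewrite FE => z /fOmega.
exists g, b => part; split => //.
- have D_t_ge0 : 0 <= D * t by rewrite mulr_ge0 ?ltW//; lra.
  apply: le_trans; first exact: Lp_norm2_sqr_le D_t_ge0 g_le.
  apply: lee_wpmul2l; first by rewrite lee_fin.
  by rewrite !Lp_norm1E.
- move=> Q QsQ; apply: eq_has_sum (b_mean Q QsQ) => z zQ /=.
  by rewrite /part /= indicE zQ mulr1.
- under eq_esum do rewrite Lp_norm1_part.
  apply: le_trans b_int _; rewrite Lp_norm1E lee_wpmul2r//.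
    by apply: esum_ge0 => z _; rewrite lee_fin mulr_ge0 ?normc_ge0 ?ltW.
Qed.
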